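(* For $t\in\mathbb{Q}$ put $$X_t=\left\{\pm\left(\tfrac{2t+1}{t^2+t+1},\tfrac{t^2-1}{t^2+t+1}\right),\ \pm\left(\tfrac{t^2-1}{t^2+t+1},-\tfrac{t(t+2)}{t^2+t+1}\right),\ \pm\left(-\tfrac{t(t+2)}{t^2+t+1},\tfrac{2t+1}{t^2+t+1}\right)\right\}.$$ Then the sets $X_t$ $(t\in\mathbb{Q})$ form an infinite family of rational ellipsoidal $5$-designs on the ellipse $C_3(1)=\{(x,y)\in\mathbb{R}^2: x^2+xy+y^2=1\}$; that is, each $X_t$ is a rational ellipsoidal $5$-design on $C_3(1)$, and there are infinitely many distinct $X_t$. In particular, $X_{t_1}=_5X_{t_2}$ $(t_1,t_2\in\mathbb{Q})$ is a parametric rational ideal solution of the two-dimensional Prouhet--Tarry--Escott problem: for all $t_1,t_2\in\mathbb{Q}$, $$\sum_{(x,y)\in X_{t_1}}x^{k_1}y^{k_2}=\sum_{(x,y)\in X_{t_2}}x^{k_1}y^{k_2}\qquad(k_1,k_2\ge0,\ 1\le k_1+k_2\le5),$$ so that whenever $X_{t_1}\cap X_{t_2}=\emptyset$ the pair $(X_{t_1},X_{t_2})$ is a rational solution of degree $5$ and size $6$.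
   Context: A finite non-empty set $X\subset C_3(1)$ is an ellipsoidal $n$-design (case $D=3$, $r=1$) if for all $f\in\mathbb{R}[x,y]$ with $\deg f\le n$, $$\frac1{\#X}\sum_{(x,y)\in X}f(x,y)=\frac{\sqrt3}{\pi}\int_{C_3(1)}f\,d\tau,\qquad d\tau=\frac{ds}{\sqrt{20x^2+20y^2+32xy}},$$ with $s$ arc length; equivalently the right-hand side is $\frac1{2\pi}\int_0^{2\pi}f\big(\cos\theta-\tfrac{\sin\theta}{\sqrt3},\tfrac{2\sin\theta}{\sqrt3}\big)d\theta$. A design is rational if all coordinates of its points are rational. A rational solution of degree $n$ and size $m$ of the two-dimensional Prouhet--Tarry--Escott problem is a disjoint pair of multisets of $m$ points of $\mathbb{Q}^2$ having equal sums of $x^{k_1}y^{k_2}$ for all $k_1,k_2\ge0$ with $1\le k_1+k_2\le n$; it is ideal if $m=n+1$. The notation $[\dots]=_n[\dots]$ means that these power-sum equalities hold. *)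

(* Defs.v *)
From HB Require Import structures.
From mathcomp Require Import all_boot all_order all_algebra.
From mathcomp Require Import finmap multiset.
(* The notations of [mpoly] clash with those of MathComp-Analysis. *)
From mathcomp Require Import -(notations) mpoly.
From mathcomp Require Import all_classical all_reals all_analysis.
From mathcomp Require Import ring lra.

Set Implicit Arguments.
Unset Strict Implicit.
Unset Printing Implicit Defensive.

Import Order.TTheory GRing.Theory Num.Theory.
Import numFieldNormedType.Exports.

Local Open Scope classical_set_scope.
Local Open Scope fset_scope.
Local Open Scope ring_scope.

Section EllipsoidalDesigns.
Context {R : realType}.
Implicit Types (X : {fset R * R}) (p : R * R).

Definition C3 : set (R * R) :=
  [set p | p.1 ^+ 2 + p.1 * p.2 + p.2 ^+ 2 = 1].

Definition C3_param (theta : R) : R * R :=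
  (cos theta - sin theta / Num.sqrt 3, 2 * sin theta / Num.sqrt 3).

Definition arc_integral (gamma : R -> R * R) (a b : R) (g : R * R -> R) : R :=
  \int[lebesgue_measure]_(theta in `[a, b])
    (g (gamma theta) *
     Num.sqrt (derive1 (fun s => (gamma s).1) theta ^+ 2 +
               derive1 (fun s => (gamma s).2) theta ^+ 2)).

Definition eval2 (f : mpoly 2 R) p : R :=
  meval (tnth [tuple p.1; p.2]) f.

Definition C3_mean (f : R * R -> R) : R :=
  Num.sqrt 3 / pi *
  arc_integral C3_param 0 (pi *+ 2)
    (fun p => f p / Num.sqrt (20 * p.1 ^+ 2 + 20 * p.2 ^+ 2 + 32 * p.1 * p.2)).

(* [msize f] is 1 + the total degree of f (and 0 for f = 0). *)
Definition ellipsoidal_design (n : nat) X : Prop :=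
  [/\ X != fset0,
      forall p, p \in X -> C3 p &
      forall f : mpoly 2 R, (msize f <= n.+1)%N ->
        (#|` X|%:R)^-1 * (\sum_(p <- X) eval2 f p) = C3_mean (eval2 f)].

Definition rational_points X : Prop :=
  forall p, p \in X -> exists a b : rat, p = (ratr a, ratr b).

Definition rational_ellipsoidal_design (n : nat) X : Prop :=
  ellipsoidal_design n X /\ rational_points X.

Definition real_points (S : {fset rat * rat}) : {fset R * R} :=
  [fset (ratr p.1 : R, ratr p.2 : R) | p in S].

(* [C3_param] runs exactly once around the ellipse on [0, 2 pi[, so that
   [arc_integral C3_param 0 (pi *+ 2)] is integration along C3 with respect to
   arc length. *)
Lemma C3_param_bij : set_bij `[0, pi *+ 2[%classic C3 C3_param.
Proof.
have s3 : Num.sqrt 3 != 0 :> R by rewrite sqrtr_eq0 -ltNge ltr0n.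
have s32 : Num.sqrt 3 ^+ 2 = 3 :> R by rewrite sqr_sqrtr.
split.
- move=> t _; rewrite /C3 /C3_param /=.
  have cs : cos t ^+ 2 = 1 - sin t ^+ 2 by rewrite -(cos2Dsin2 t) addrK.
  apply: (mulIf (expf_neq0 2 s3)).
  have -> : ((cos t - sin t / Num.sqrt 3) ^+ 2 +
    (cos t - sin t / Num.sqrt 3) * (2 * sin t / Num.sqrt 3) +
    (2 * sin t / Num.sqrt 3) ^+ 2) * Num.sqrt 3 ^+ 2 =
    cos t ^+ 2 * Num.sqrt 3 ^+ 2 + 3 * sin t ^+ 2 :> R by field.
  by rewrite s32 cs; ring.
- move=> s t; rewrite !inE /= !in_itv /= => /andP[s0 s2] /andP[t0 t2].
  rewrite /C3_param => -[e1 e2].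
  have es : sin s = sin t.
    have := congr1 (fun z => z * Num.sqrt 3 / 2) e2.
    by rewrite /= !divfK // ![2 * _]mulrC !mulfK // pnatr_eq0.
  have {e1} ec : cos s = cos t by move: e1; rewrite es => /addIr.
  wlog st : s t s0 s2 t0 t2 {e2} es ec / s <= t.
    move=> W; case: (leP s t) => [|/ltW] st; first exact: W.
    by apply/esym; apply: W.
  have c1 : cos (t - s) = 1.
    by rewrite cosB es ec -!expr2 cos2Dsin2.
  have sh : sin ((t - s) / 2) = 0.
    have := c1; rewrite -{1}[t - s](@divfK _ 2) ?pnatr_eq0 // mulr_natr.
    rewrite cos_mulr2n => h.
    have := cos2Dsin2 ((t - s) / 2) => h2.
    by apply/eqP; rewrite -sqrf_eq0; apply/eqP; move: h h2;
      set c := cos _; set d := sin _ => h h2; lra.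
  have [//|lt_st] := eqVneq s t.
  have : 0 < sin ((t - s) / 2).
    apply: sin_gt0_pi.
    have : s < t by rewrite lt_neqAle lt_st.
    by move=> ?; apply/andP; split; move: s2 t2; rewrite mulr2n; lra.
  by rewrite sh ltxx.
- move=> [x y] /=; rewrite /C3 /= => xy.
  pose u := x + y / 2; pose v := Num.sqrt 3 * y / 2.
  have uv : u ^+ 2 + v ^+ 2 = 1.
    rewrite -xy /u /v.
    have -> : (Num.sqrt 3 * y / 2) ^+ 2 = Num.sqrt 3 ^+ 2 * y ^+ 2 / 4 :> R by field.
    by rewrite s32; field.
  have u1 : -1 <= u <= 1.
    have : u ^+ 2 <= 1 by rewrite -uv lerDl sqr_ge0.
    by move=> h; apply/andP; split; nra.
  have H t : cos t = u -> sin t = v -> C3_param t = (x, y).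
    move=> ct st; rewrite /C3_param ct st /u /v; congr pair; by field.
  have ca : cos (acos u) = u by apply: acosK; rewrite in_itv.
  have sa : sin (acos u) = `|v|.
    by rewrite sin_acos // -sqrtr_sqr; congr Num.sqrt; rewrite -uv; ring.
  have [a0 api] := (acos_ge0 u1, acos_lepi u1).
  have p0 := pi_gt0 R.
  have [v0|v0] := leP 0 v.
    exists (acos u); last by apply: H => //; rewrite sa ger0_norm.
    by rewrite /= in_itv /= a0 /= mulr2n; lra.
  exists (pi *+ 2 - acos u).
    have : 0 < acos u.
      rewrite lt_neqAle a0 andbT; apply/eqP => e.
      by move: sa; rewrite -e sin0 => /esym/eqP; rewrite normr_eq0 lt_eqF.
    by move=> ?; rewrite /= in_itv /= mulr2n; apply/andP; split; lra.
  apply: H.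
    by rewrite addrC cosD2pi cosN.
  by rewrite addrC sinD2pi sinN sa ltr0_norm // opprK.
Qed.

End EllipsoidalDesigns.

Arguments C3 : clear implicits.

Section ProuhetTarryEscott.
Implicit Types A B : {mset (rat * rat)}%mset.

Definition power_sum (k1 k2 : nat) A : rat :=
  \sum_(p <- A) p.1 ^+ k1 * p.2 ^+ k2.

Definition pte_eq (n : nat) A B : Prop :=
  forall k1 k2 : nat, (1 <= k1 + k2 <= n)%N ->
    power_sum k1 k2 A = power_sum k1 k2 B.

Definition pte_solution (n m : nat) A B : Prop :=
  [/\ size A = m, size B = m, mdisjoint A B & pte_eq n A B].

Definition ideal_pte_solution (n m : nat) A B : Prop :=
  pte_solution n m A B /\ m = n.+1.

End ProuhetTarryEscott.

Definition Xfam (t : rat) : {fset rat * rat} :=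
  let q := t ^+ 2 + t + 1 in
  let p1 := ((2 * t + 1) / q, (t ^+ 2 - 1) / q) in
  let p2 := ((t ^+ 2 - 1) / q, - (t * (t + 2)) / q) in
  let p3 := (- (t * (t + 2)) / q, (2 * t + 1) / q) in
  [fset p1; - p1; p2; - p2; p3; - p3].

(* Main.v *)
Require Import Defs.
From HB Require Import structures.
From mathcomp Require Import all_boot all_order all_algebra.
From mathcomp Require Import finmap multiset.
From mathcomp Require Import -(notations) mpoly.
From mathcomp Require Import all_classical all_reals all_analysis.
From mathcomp Require Import ring lra.

Import Order.TTheory GRing.Theory Num.Theory.
Import numFieldNormedType.Exports.

Local Open Scope classical_set_scope.
Local Open Scope fset_scope.
Local Open Scope ring_scope.

(** The six points of [X_t] form an orbit of the order 6 linear map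
    [(x, y) |-> (-y, x + y)], which preserves [q = x^2 + xy + y^2]. The sum of a
    monomial of degree [k <= 5] over such an orbit is a constant times
    [q ^ (k / 2)] (zero for odd [k]), hence independent of the orbit. On the
    integral side, the moments of the ellipse satisfy linear relations, obtained
    by multiplying a monomial by [q = 1] and by integrating the derivative of a
    monomial along the ellipse; in degree at most 5 these relations determine all
    moments, and the orbit averages at [(1, 0)] have the same values. *)

(** * Orbits of the order 6 map and their monomial sums *)

Section Hexagon.
Context {F : realFieldType}.
Implicit Types a b : F.

(** Up to sign, the points are the pairs of cyclically consecutive entries of the zero-sum triple
    [a], [b], [- a - b], listed in the order of [Xfam]. *)
Definition hexagon a b : {fset F * F} :=
  [fset (a, b); - (a, b); (b, - a - b); - (b, - a - b);
        (- a - b, a); - (- a - b, a)].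

Definition hexagon_sum (f : F * F -> F) a b : F :=
  f (a, b) + f (- (a, b)) + f (b, - a - b) + f (- (b, - a - b)) +
  f (- a - b, a) + f (- (- a - b, a)).

Definition monomial (k1 k2 : nat) (p : F * F) : F := p.1 ^+ k1 * p.2 ^+ k2.

(** Two equal entries would give a fixed point of a nontrivial power of the order 6 map; this forces
    [a = b = 0], against the hypothesis. *)
Lemma perm_hexagon a b : a ^+ 2 + a * b + b ^+ 2 = 1 ->
  perm_eq (hexagon a b)
    [:: (a, b); - (a, b); (b, - a - b); - (b, - a - b);
        (- a - b, a); - (- a - b, a)].
Proof.
move=> ab1; apply: uniq_perm; first exact: fset_uniq; last first.
  by move=> p; rewrite !inE -!orbA.
rewrite /= !inE !negb_or /= -!andbA.
do !(apply/andP; split) => //; apply/eqP; case=> e1 e2;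
  have [a0 b0] : a = 0 /\ b = 0 by [split; lra | split; nra].
all: by move: ab1; rewrite a0 b0; lra.
Qed.

Lemma big_hexagon (f : F * F -> F) a b : a ^+ 2 + a * b + b ^+ 2 = 1 ->
  \sum_(p <- hexagon a b) f p = hexagon_sum f a b.
Proof.
move=> /perm_hexagon pe; rewrite (perm_big _ pe) /=.
by rewrite !big_cons big_nil addr0 !addrA.
Qed.

Lemma hexagon_sum_monomial (k1 k2 : nat) a b : (k1 + k2 <= 5)%N ->
  a ^+ 2 + a * b + b ^+ 2 = 1 ->
  hexagon_sum (monomial k1 k2) a b = hexagon_sum (monomial k1 k2) 1 0.
Proof.
move=> k5 ab1.
(* In this homogeneous form the equality is a polynomial identity in [a] and [b], so [ring] settles
   each of the 21 exponent pairs. For odd degree the constant is zero, so the rounding in the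
   exponent is harmless. *)
transitivity (hexagon_sum (monomial k1 k2) 1 0 *
              (a ^+ 2 + a * b + b ^+ 2) ^+ (k1 + k2)./2); last first.
  by rewrite ab1 expr1n mulr1.
rewrite /hexagon_sum /monomial {ab1}.
case: k1 k5 => [|[|[|[|[|[|k1]]]]]] k5 //;
  case: k2 k5 => [|[|[|[|[|[|k2]]]]]] k5 //=; ring.
Qed.

End Hexagon.

(** * Integrals of continuous functions over a segment *)

Section Mean.
Context {R : realType}.
Implicit Types f F : R -> R.

Local Notation mu := lebesgue_measure.

Lemma continuous_integrable_itvcc f (a b : R) : continuous f ->
  mu.-integrable `[a, b] (EFin \o f).
Proof.
move=> cf; apply: continuous_compact_integrable; first exact: segment_compact.
exact: continuous_subspaceT.
Qed.

Lemma continuous_linear_sum (T : Type) (s : seq T) (c : T -> R)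
    (h : T -> R -> R) : (forall i, continuous (h i)) ->
  continuous (fun x => \sum_(i <- s) c i * h i x).
Proof.
move=> ch; elim: s => [|i s IH].
  by under eq_fun do rewrite big_nil; move=> x; exact: cvg_cst.
under eq_fun do rewrite big_cons.
by move=> x; apply: cvgD; [apply: cvgM; [exact: cvg_cst|exact: ch]|exact: IH].
Qed.

Lemma Rintegral_itvcc_sum (T : Type) (s : seq T) (c : T -> R)
    (h : T -> R -> R) (a b : R) : (forall i, continuous (h i)) ->
  \int[mu]_(x in `[a, b]) (\sum_(i <- s) c i * h i x) =
  \sum_(i <- s) c i * \int[mu]_(x in `[a, b]) h i x.
Proof.
move=> ch; elim: s => [|i s IH].
  rewrite big_nil; under eq_Rintegral do rewrite big_nil.
  by rewrite Rintegral_cst// mul0r.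
rewrite big_cons -IH -RintegralZl//; last exact: continuous_integrable_itvcc.
under eq_Rintegral do rewrite big_cons.
rewrite RintegralD//; apply: continuous_integrable_itvcc.
  by move=> x; apply: cvgM; [exact: cvg_cst|exact: ch].
exact: continuous_linear_sum.
Qed.

Lemma is_derive_continuous F f : (forall x : R, is_derive x 1 F (f x)) ->
  continuous F.
Proof.
by move=> dF x; apply/differentiable_continuous/derivable1_diffP; exact: ex_derive.
Qed.

Lemma Rintegral_derive1 F f (a b : R) : a < b -> continuous f ->
  (forall x : R, is_derive x 1 F (f x)) ->
  \int[mu]_(x in `[a, b]) f x = F b - F a.
Proof.
move=> ab cf dF.
have cF := is_derive_continuous _ _ dF.
rewrite /Rintegral (@continuous_FTC2 _ f F)//.
- exact: continuous_subspaceT.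
- split=> [x _||]; first exact: ex_derive.
  + exact/cvg_at_right_filter/cF.
  + exact/cvg_at_left_filter/cF.
- by move=> x _; rewrite derive1E; exact: derive_val.
Qed.

(** * The parametrised ellipse and derivatives along it *)

Lemma sqrt3_neq0 : Num.sqrt 3 != 0 :> R.
Proof. by rewrite sqrtr_eq0 -ltNge ltr0n. Qed.

Lemma sqr_sqrt3 : Num.sqrt 3 ^+ 2 = 3 :> R.
Proof. by rewrite sqr_sqrtr. Qed.

(** The velocity is written as a linear function of the point itself, so that differentiating a
    monomial along the curve yields monomials of the same degree. *)
Lemma is_derive_C3_param1 (t : R) :
  is_derive t 1 (fun s : R => (C3_param s).1)
    (- ((C3_param t).1 + 2 * (C3_param t).2) / Num.sqrt 3).
Proof.
rewrite /C3_param /=; apply: is_derive_eq; rewrite /GRing.scale /=.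
have := sqr_sqrt3; have := sqrt3_neq0; move: (Num.sqrt 3) => r r0 r3.
(* Writing 1 as [3 / r ^+ 2] confines the use of [r ^+ 2 = 3] to one rewrite; the rest holds for any
   nonzero [r]. *)
transitivity (- cos t / r - sin t * (3 / r ^+ 2)); last by field.
by rewrite r3; field.
Qed.

Lemma is_derive_C3_param2 (t : R) :
  is_derive t 1 (fun s : R => (C3_param s).2)
    ((2 * (C3_param t).1 + (C3_param t).2) / Num.sqrt 3).
Proof.
rewrite /C3_param /=; apply: is_derive_eq; rewrite /GRing.scale /=.
by have := sqrt3_neq0; move: (Num.sqrt 3) => r r0; field.
Qed.

Lemma C3_param_C3 (t : R) : C3 R (C3_param t).
Proof.
rewrite /C3 /C3_param /=.
have expand (r c s : R) : r != 0 ->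
    (c - s / r) ^+ 2 + (c - s / r) * (2 * s / r) + (2 * s / r) ^+ 2 =
    c ^+ 2 + s ^+ 2 * (3 / r ^+ 2).
  by move=> r0; field.
rewrite (expand _ _ _ sqrt3_neq0) sqr_sqrt3.
by rewrite divff ?pnatr_eq0// mulr1 cos2Dsin2.
Qed.

(** When an exponent is 0, its truncated predecessor is harmless, since the coefficient in front
    vanishes. *)
Lemma is_derive_monomial (k1 k2 : nat) (t : R) :
  is_derive t 1 (fun s : R => monomial k1 k2 (C3_param s))
    ((Num.sqrt 3)^-1 * ((k2%:R - k1%:R) * monomial k1 k2 (C3_param t)
      - 2 * k1%:R * monomial k1.-1 k2.+1 (C3_param t)
      + 2 * k2%:R * monomial k1.+1 k2.-1 (C3_param t))).
Proof.
have dX := is_deriveX k1 (is_derive_C3_param1 t).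
have dY := is_deriveX k2 (is_derive_C3_param2 t).
have -> : (fun s : R => monomial k1 k2 (C3_param s)) =
    (fun s => (C3_param s).1) ^+ k1 * (fun s => (C3_param s).2) ^+ k2.
  by apply/funext => s; rewrite !fctE.
apply: (is_derive_eq (is_deriveM dX dY)).
rewrite !fctE /monomial {dX dY}; case: (C3_param t) => x y.
have := sqrt3_neq0; rewrite /GRing.scale /=; move: (Num.sqrt 3) => r r0.
by case: k1 k2 => [|k1] [|k2] /=; rewrite !exprS ?expr0; field.
Qed.

Lemma continuous_monomial_C3_param (k1 k2 : nat) :
  continuous (fun t : R => monomial k1 k2 (C3_param t)).
Proof. by apply: is_derive_continuous => t; exact: is_derive_monomial. Qed.

(** * Moments of the ellipse in degree at most 5 *)

Definition C3_moment (k1 k2 : nat) : R :=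
  (2 * pi)^-1 *
  \int[mu]_(t in `[0, pi *+ 2]) monomial k1 k2 (C3_param t).

Lemma mean_monomial_sum (T : Type) (s : seq T) (c : T -> R) (k l : T -> nat) :
  (2 * pi)^-1 * \int[mu]_(t in `[0, pi *+ 2])
    (\sum_(i <- s) c i * monomial (k i) (l i) (C3_param t)) =
  \sum_(i <- s) c i * C3_moment (k i) (l i).
Proof.
rewrite (Rintegral_itvcc_sum _ s c
  (fun i t => monomial (k i) (l i) (C3_param t))) => [|i]; last first.
  exact: continuous_monomial_C3_param.
by rewrite mulr_sumr; apply: eq_bigr => i _; rewrite mulrCA.
Qed.

Lemma C3_moment00 : C3_moment 0 0 = 1.
Proof.
rewrite /C3_moment /monomial; under eq_Rintegral do rewrite !expr0 mulr1.
have p0 := pi_gt0 R; have p2 : 0 < pi *+ 2 :> R by rewrite pmulrn_lgt0.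
rewrite Rintegral_cst//= lebesgue_measure_itv/= lte_fin p2 /= subr0 mul1r.
by rewrite -[pi *+ 2]mulr_natl mulVf// mulf_neq0 ?pnatr_eq0// gt_eqF.
Qed.

Lemma C3_moment_quadratic (k1 k2 : nat) :
  C3_moment k1.+2 k2 + C3_moment k1.+1 k2.+1 + C3_moment k1 k2.+2 =
  C3_moment k1 k2.
Proof.
have := mean_monomial_sum _ [:: (k1.+2, k2); (k1.+1, k2.+1); (k1, k2.+2)]
  (fun=> 1) fst snd.
rewrite !big_cons big_nil /= addr0 !mul1r addrA => <-; congr (_ * _).
apply: eq_Rintegral => t _; rewrite !big_cons big_nil /monomial.
have := C3_param_C3 t; case: (C3_param t) => x y; rewrite /C3 /= => xy1.
transitivity (x ^+ k1 * y ^+ k2 * (x ^+ 2 + x * y + y ^+ 2)).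
  by rewrite !exprS; ring.
by rewrite xy1 mulr1.
Qed.

(* The mean of the derivative of a monomial along the ellipse vanishes. *)
Lemma C3_moment_derive (k1 k2 : nat) :
  (k2%:R - k1%:R) * C3_moment k1 k2
  - 2 * k1%:R * C3_moment k1.-1 k2.+1
  + 2 * k2%:R * C3_moment k1.+1 k2.-1 = 0.
Proof.
pose s : seq (R * (nat * nat)) :=
  [:: ((Num.sqrt 3)^-1 * (k2%:R - k1%:R), (k1, k2));
      ((Num.sqrt 3)^-1 * (- (2 * k1%:R)), (k1.-1, k2.+1));
      ((Num.sqrt 3)^-1 * (2 * k2%:R), (k1.+1, k2.-1))].
pose f t : R := \sum_(c <- s) c.1 * monomial c.2.1 c.2.2 (C3_param t).
have cf : continuous f.
  by apply: continuous_linear_sum => c; exact: continuous_monomial_C3_param.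
have df (t : R) : is_derive t 1 (fun u : R => monomial k1 k2 (C3_param u)) (f t).
  apply: (is_derive_eq (is_derive_monomial k1 k2 t)).
  by rewrite /f /s !big_cons big_nil; case: (C3_param t) => x y /=; ring.
have p2 : 0 < pi *+ 2 :> R by rewrite pmulrn_lgt0// pi_gt0.
have := mean_monomial_sum _ s fst (fun c => c.2.1) (fun c => c.2.2).
rewrite (Rintegral_derive1 _ _ _ _ p2 cf df).
(* The curve is closed, so the boundary terms of the fundamental theorem cancel. *)
have -> : C3_param (pi *+ 2) = C3_param (0 : R).
  by rewrite /C3_param cos2pi sin2pi cos0 sin0.
rewrite subrr mulr0 /s !big_cons big_nil /= => /esym e.
apply: (mulfI (invr_neq0 sqrt3_neq0)); rewrite mulr0 -[RHS]e; ring.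
Qed.

(** In odd degree the derivative relations alone form an invertible linear system, hence all moments
    vanish. *)
Lemma C3_moment_degree1 : C3_moment 1 0 = 0 /\ C3_moment 0 1 = 0.
Proof.
move: (C3_moment_derive 1 0) (C3_moment_derive 0 1).
by move=> /=; split; lra.
Qed.

(** In even degree the derivative relations leave one free scalar; the quadratic relation fixes it
    from the moments two degrees lower. *)
Lemma C3_moment_degree2 :
  [/\ C3_moment 2 0 = 2 / 3, C3_moment 1 1 = - (1 / 3) & C3_moment 0 2 = 2 / 3].
Proof.
have m0 := C3_moment00.
move: (C3_moment_quadratic 0 0) (C3_moment_derive 2 0).
move: (C3_moment_derive 1 1) (C3_moment_derive 0 2).
by move=> /=; split; lra.
Qed.

Lemma C3_moment_degree3 :
  [/\ C3_moment 3 0 = 0, C3_moment 2 1 = 0, C3_moment 1 2 = 0 &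
      C3_moment 0 3 = 0].
Proof.
move: (C3_moment_derive 3 0) (C3_moment_derive 2 1).
move: (C3_moment_derive 1 2) (C3_moment_derive 0 3).
by move=> /=; split; lra.
Qed.

Lemma C3_moment_degree4 :
  [/\ C3_moment 4 0 = 2 / 3, C3_moment 3 1 = - (1 / 3),
      C3_moment 2 2 = 1 / 3, C3_moment 1 3 = - (1 / 3) &
      C3_moment 0 4 = 2 / 3].
Proof.
have [m20 m11 m02] := C3_moment_degree2.
move: (C3_moment_quadratic 2 0) (C3_moment_quadratic 1 1).
move: (C3_moment_quadratic 0 2) (C3_moment_derive 4 0).
move: (C3_moment_derive 3 1) (C3_moment_derive 2 2).
move: (C3_moment_derive 1 3) (C3_moment_derive 0 4).
by move=> /=; split; lra.
Qed.

Lemma C3_moment_degree5 :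
  [/\ C3_moment 5 0 = 0, C3_moment 4 1 = 0 & C3_moment 3 2 = 0] /\
  [/\ C3_moment 2 3 = 0, C3_moment 1 4 = 0 & C3_moment 0 5 = 0].
Proof.
move: (C3_moment_derive 5 0) (C3_moment_derive 4 1).
move: (C3_moment_derive 3 2) (C3_moment_derive 2 3).
move: (C3_moment_derive 1 4) (C3_moment_derive 0 5).
by move=> /=; split; split; lra.
Qed.

(** The orbit of [(1, 0)] serves as reference because its monomial sums are explicit integers, to be
    compared with the computed moments. *)
Lemma C3_moment_hexagon (k1 k2 : nat) : (k1 + k2 <= 5)%N ->
  C3_moment k1 k2 = hexagon_sum (monomial k1 k2) 1 0 / 6.
Proof.
have [m10 m01] := C3_moment_degree1; have [m20 m11 m02] := C3_moment_degree2.
have [m30 m21 m12 m03] := C3_moment_degree3.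
have [m40 m31 m22 m13 m04] := C3_moment_degree4.
have [[m50 m41 m32] [m23 m14 m05]] := C3_moment_degree5.
rewrite /hexagon_sum /monomial /=.
case: k1 => [|[|[|[|[|[|k1]]]]]] //; case: k2 => [|[|[|[|[|[|k2]]]]]] // _.
all: rewrite ?(C3_moment00, m10, m01, m20, m11, m02, m30, m21, m12, m03, m40,
  m31, m22, m13, m04, m50, m41, m32, m23, m14, m05).
all: by field.
Qed.

(** * From moments to means of polynomials *)

Lemma eval2_monomial (f : mpoly 2 R) (p : R * R) :
  eval2 f p = \sum_(m <- msupp f) mcoeff m f *
    monomial (m ord0) (m (lift ord0 ord0)) p.
Proof.
rewrite /eval2 mevalE; apply: eq_bigr => m _.
by rewrite !big_ord_recl big_ord0 mulr1.
Qed.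

(* [20 x^2 + 20 y^2 + 32 x y] is 12 times the squared speed of [C3_param]. *)
Lemma C3_meanE (f : R * R -> R) : continuous (fun t => f (C3_param t)) ->
  C3_mean f = (2 * pi)^-1 * \int[mu]_(t in `[0, pi *+ 2]) f (C3_param t).
Proof.
move=> cf; rewrite /C3_mean /arc_integral.
pose r : R := Num.sqrt 3; rewrite -/r.
have r_ge0 : 0 <= r := sqrtr_ge0 3.
have r3 : r ^+ 2 = 3 := sqr_sqrt3; have r0 : r != 0 := sqrt3_neq0.
(* The speed divided by the weight is the constant [(2 * r)^-1], which turns the prefactor [r / pi]
   into [(2 * pi)^-1]. *)
transitivity (r / pi * \int[mu]_(t in `[0, pi *+ 2])
                ((2 * r)^-1 * f (C3_param t))); last first.
  rewrite RintegralZl//; last exact: continuous_integrable_itvcc.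
  rewrite mulrA; congr (_ * _).
  have : pi != 0 :> R by rewrite gt_eqF ?pi_gt0.
  by move: pi => p p0; field; rewrite p0 r0.
congr (_ * _); apply: eq_Rintegral => t _; rewrite !derive1E.
have -> := @derive_val _ _ _ _ _ _ _ (is_derive_C3_param1 t).
have -> := @derive_val _ _ _ _ _ _ _ (is_derive_C3_param2 t).
have := C3_param_C3 t; case: (C3_param t) => x y; rewrite /C3 /= => xy1.
rewrite -/r.
set v := (_ ^+ 2 + _ ^+ 2).
have -> : 20 * x ^+ 2 + 20 * y ^+ 2 + 32 * x * y = (2 * r) ^+ 2 * v.
  by rewrite /v; field; exact: r0.
have v0 : 0 < v.
  have -> : v = (5 * x ^+ 2 + 8 * x * y + 5 * y ^+ 2) / 3.
    rewrite -[in RHS]r3 /v; field; exact: r0.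
  (* On the ellipse the numerator equals [2 + 3 * (x + y) ^+ 2]. *)
  by have xy_ge0 := sqr_ge0 (x + y); rewrite divr_gt0//; lra.
rewrite sqrtrM ?sqr_ge0// sqrtr_sqr ger0_norm ?mulr_ge0//.
by field; rewrite r0 gt_eqF// sqrtr_gt0.
Qed.

Lemma C3_mean_eval2 (f : mpoly 2 R) :
  C3_mean (eval2 f) =
  \sum_(m <- msupp f) mcoeff m f * C3_moment (m ord0) (m (lift ord0 ord0)).
Proof.
rewrite (funext (eval2_monomial f)) C3_meanE; last first.
  apply: (continuous_linear_sum _ _ (fun m => mcoeff m f)
    (fun m t => monomial (m ord0) (m (lift ord0 ord0)) (C3_param t))) => m.
  exact: continuous_monomial_C3_param.
exact: (mean_monomial_sum _ (msupp f) (fun m => mcoeff m f) (fun m => m ord0)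
  (fun m => m (lift ord0 ord0))).
Qed.

Lemma hexagon_design (a b : R) : a ^+ 2 + a * b + b ^+ 2 = 1 ->
  ellipsoidal_design 5 (hexagon a b).
Proof.
move=> ab1; have pe := perm_hexagon _ _ ab1; split.
- by rewrite -cardfs_gt0 (perm_size pe).
- move=> p; rewrite (perm_mem pe) /C3 !inE.
  by do ![move=> /orP[]]; move=> /eqP -> /=; rewrite -ab1; ring.
- move=> f f6; rewrite C3_mean_eval2 (perm_size pe) /=.
  under eq_bigr do rewrite eval2_monomial.
  rewrite exchange_big mulr_sumr /=; apply: eq_big_seq => m mf.
  rewrite -mulr_sumr big_hexagon// mulrCA [6^-1 * _]mulrC.
  (* As [msize] exceeds the degree by one, the bound 6 on it means total degree at most 5. *)
  have m5 : (m ord0 + m (lift ord0 ord0) <= 5)%N.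
    have := leq_trans (msize_mdeg_lt mf) f6.
    by rewrite mdegE !big_ord_recl big_ord0 addn0.
  by rewrite hexagon_sum_monomial// C3_moment_hexagon.
Qed.

End Mean.

(** * The rational family [Xfam] *)

Definition Xfam_x (t : rat) : rat := (2 * t + 1) / (t ^+ 2 + t + 1).
Definition Xfam_y (t : rat) : rat := (t ^+ 2 - 1) / (t ^+ 2 + t + 1).

Lemma Xfam_denom_gt0 (t : rat) : 0 < t ^+ 2 + t + 1.
Proof.
have -> : t ^+ 2 + t + 1 = (t + 1 / 2) ^+ 2 + 3 / 4 by field.
by rewrite ltr_wpDl ?sqr_ge0.
Qed.

Lemma Xfam_quadratic (t : rat) :
  Xfam_x t ^+ 2 + Xfam_x t * Xfam_y t + Xfam_y t ^+ 2 = 1.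
Proof. by rewrite /Xfam_x /Xfam_y; field; rewrite gt_eqF ?Xfam_denom_gt0. Qed.

(** The numerator [- (t * (t + 2))] is minus the sum of [2 * t + 1] and [t ^+ 2 - 1]. *)
Lemma XfamE (t : rat) : Xfam t = hexagon (Xfam_x t) (Xfam_y t).
Proof.
have := Xfam_denom_gt0 t; rewrite /Xfam /hexagon /Xfam_x /Xfam_y.
set q := (t ^+ 2 + t + 1) => q0.
have -> // : - (t * (t + 2)) / q = - ((2 * t + 1) / q) - (t ^+ 2 - 1) / q.
by rewrite /q; field; rewrite gt_eqF.
Qed.

Lemma real_points_hexagon (R : realType) (a b : rat) :
  (real_points (hexagon a b) : {fset R * R}) = hexagon (ratr a) (ratr b).
Proof.
rewrite /real_points /hexagon !imfsetU !imfset_fset1 /=.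
by rewrite !rmorphN !rmorphB !rmorphN.
Qed.

Lemma ratr_quadratic (R : realType) (a b : rat) :
  a ^+ 2 + a * b + b ^+ 2 = 1 ->
  ratr a ^+ 2 + ratr a * ratr b + ratr b ^+ 2 = 1 :> R.
Proof.
by move=> ab1; rewrite -!rmorphXn -rmorphM -!rmorphD ab1 rmorph1.
Qed.

(* The point [(a, b)] is the only one of its hexagon with positive coordinates. *)
Lemma hexagon_inj (F : realFieldType) (a b a' b' : F) :
  0 < a -> 0 < b -> 0 < a' -> 0 < b' -> hexagon a b = hexagon a' b' ->
  a = a' /\ b = b'.
Proof.
move=> a0 b0 a'0 b'0 e.
have : (a, b) \in hexagon a' b' by rewrite -e !inE eqxx.
rewrite !inE; do ![move=> /orP[]]; move=> /eqP[] => ? ?; split; lra.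
Qed.

(** For [t > 1] both coordinates of the first point are positive, so the set determines that point,
    and the point determines [t]. *)
Lemma Xfam_inj (R : realType) (t1 t2 : rat) : 1 < t1 -> 1 < t2 ->
  (real_points (Xfam t1) : {fset R * R}) = real_points (Xfam t2) -> t1 = t2.
Proof.
have x_gt0 t : 1 < t -> 0 < ratr (Xfam_x t) :> R.
  by move=> t_gt1; rewrite ltr0q divr_gt0 ?Xfam_denom_gt0//; lra.
have y_gt0 t : 1 < t -> 0 < ratr (Xfam_y t) :> R.
  by move=> t_gt1; rewrite ltr0q divr_gt0 ?Xfam_denom_gt0//; nra.
move=> gt1 gt2; rewrite !XfamE !real_points_hexagon => /hexagon_inj.
case=> [||||/fmorph_inj ex /fmorph_inj ey]; rewrite ?x_gt0 ?y_gt0//.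
(* The line joining [(0, 1)] to the point gives a relation linear in [t]. *)
have xy t : Xfam_x t * (t + 2) = (1 - Xfam_y t) * (2 * t + 1).
  by rewrite /Xfam_x /Xfam_y; field; rewrite gt_eqF ?Xfam_denom_gt0.
have := xy t1; have := xy t2; rewrite ex ey.
have := Xfam_quadratic t2; have := y_gt0 _ gt2; have := x_gt0 _ gt2.
rewrite !ltr0q.
move: (Xfam_x t2) (Xfam_y t2) => x y x0 y0 q e2 e1.
have : (t1 - t2) * (x - 2 * (1 - y)) = 0 by lra.
move/eqP; rewrite mulf_eq0 subr_eq0 => /orP[/eqP //|/eqP e3].
(* This line is tangent to the ellipse at [(0, 1)]: substitution gives [3 * (y - 1) ^+ 2 = 0], hence
   [x = 0], against [x0]. *)
have {}e3 : x = 2 * (1 - y) by lra.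
by move: q x0; rewrite e3 => q x0; nra.
Qed.

Lemma size_Xfam (t : rat) : size (seq_mset (Xfam t)) = 6.
Proof.
rewrite (perm_size (perm_eq_seq_mset _)) XfamE.
by rewrite (perm_size (perm_hexagon _ _ (Xfam_quadratic t))).
Qed.

Lemma Xfam_pte (t1 t2 : rat) (k1 k2 : nat) : (k1 + k2 <= 5)%N ->
  \sum_(p <- Xfam t1) p.1 ^+ k1 * p.2 ^+ k2 =
  \sum_(p <- Xfam t2) p.1 ^+ k1 * p.2 ^+ k2.
Proof.
move=> k5; rewrite !XfamE.
rewrite !(big_hexagon (monomial k1 k2)) ?Xfam_quadratic//.
by rewrite !(hexagon_sum_monomial _ _ (Xfam_x _)) ?Xfam_quadratic.
Qed.

Theorem theorem5p5 (R : realType) :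
  [/\ forall t : rat,
        rational_ellipsoidal_design 5 (real_points (Xfam t) : {fset R * R}),
      infinite_set (range (fun t : rat => real_points (Xfam t) : {fset R * R})),
      forall (t1 t2 : rat) (k1 k2 : nat), (1 <= k1 + k2 <= 5)%N ->
        \sum_(p <- Xfam t1) p.1 ^+ k1 * p.2 ^+ k2 =
        \sum_(p <- Xfam t2) p.1 ^+ k1 * p.2 ^+ k2 &
      forall t1 t2 : rat, Xfam t1 `&` Xfam t2 = fset0 ->
        ideal_pte_solution 5 6 (seq_mset (Xfam t1)) (seq_mset (Xfam t2))].
Proof.
split.
- move=> t; split; last by move=> p /imfsetP[q _ ->]; exists q.1, q.2.
  rewrite XfamE real_points_hexagon.
  exact/hexagon_design/ratr_quadratic/Xfam_quadratic.
(* The shift by 2 keeps the parameter above 1, where [Xfam_inj] applies. *)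
- pose f (n : nat) : {fset R * R} := real_points (Xfam n.+2%:R).
  apply: (@sub_infinite_set _ (range f)) => [_ [n _ <-]|].
    by exists n.+2%:R.
  rewrite (eq_finite_set (inj_card_eq _)); first exact: infinite_nat.
  move=> m n _ _ /Xfam_inj; rewrite !ltr1n => /(_ isT isT)/eqP.
  by rewrite eqr_nat => /eqP[].
- by move=> t1 t2 k1 k2 /andP[_ k5]; exact: Xfam_pte.
- move=> t1 t2 X12; split=> //; split; rewrite ?size_Xfam//.
    (* Multiplicities in the intersection are minima, and each point is missing from one of the two
       sets. *)
    apply/eqP/msetP => p; rewrite msetE2 !mset_seqE mset0E.
    have := in_fset0 p; rewrite -X12 in_fsetI => /negbT.
    by rewrite negb_and => /orP[] /count_memPn ->; rewrite ?min0n ?minn0.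
  move=> k1 k2 /andP[_ k5]; rewrite /power_sum.
  rewrite (perm_big _ (perm_eq_seq_mset (Xfam t1))) /=.
  by rewrite (perm_big _ (perm_eq_seq_mset (Xfam t2))) /=; exact: Xfam_pte.
Qed.
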